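(* Assume the setting described in the context, let $\theta\in\mathbb R^{\mathfrak d}$, for $k\in\{1,\dots,L\}$, $i\in\{1,\dots,\ell_k\}$ let $Q_{k,i}=|\mathfrak b^{k,\theta}_i|^2+\sum_{j=1}^{\ell_{k-1}}|\mathfrak w^{k,\theta}_{i,j}|^2$, and let $\mathcal Q_0=1$ and $\mathcal Q_k=1+\sum_{i=1}^{\ell_k}Q_{k,i}$ for $k\in\{1,\dots,L\}$. Then (i) for all $k\in\{1,\dots,L\}$, $i\in\{1,\dots,\ell_k\}$, $x\in[a,b]^{\ell_0}$ it holds that $|\mathscr R_\infty(\mathcal N^{k,\theta}_{\infty,i}(x))|^2\le|\mathcal N^{k,\theta}_{\infty,i}(x)|^2\le\mathbf a^2Q_{k,i}\prod_{p=0}^{k-1}((\ell_p+1)\mathcal Q_p)$; (ii) for all $K\in\{1,\dots,L\}$ it holds that $\prod_{p=0}^K\mathcal Q_p\le(\|\theta\|^2+1)^K$; (iii) for all $K\in\{1,\dots,L\}$, $k\in\{1,\dots,K\}$, $i\in\{1,\dots,\ell_k\}$ it holds that $\sum_{v_k,\dots,v_K}\mathbf 1_{\{i\}}(v_k)\prod_{n=k+1}^K|\mathfrak w^{n,\theta}_{v_n,v_{n-1}}|^2\le\|\theta\|^{2(K-k)}$, where the sum runs over all $(v_k,\dots,v_K)\in\mathbb N^{K-k+1}$ with $v_w\le\ell_w$ for $w\in\{k,\dots,K\}$ and empty products equal $1$; (iv) $\|\mathcal G(\theta)\|^2\le4L\mathfrak m\mathbf a^2\big[\prod_{p=0}^L(\ell_p+1)\big](\|\theta\|^2+1)^{L-1}\mathcal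 L_\infty(\theta)$.
   Context: Setting. Let $L,\mathfrak d\in\mathbb N=\{1,2,\dots\}$, $(\ell_k)_{k\in\mathbb N_0}\subseteq\mathbb N$, $a\in\mathbb R$, $b\in(a,\infty)$, $\mathscr A\in(0,\infty)$, $\mathscr B\in(\mathscr A,\infty)$ with $\mathfrak d=\sum_{k=1}^L\ell_k(\ell_{k-1}+1)$; let $\mathbf a=\max\{|a|,|b|,1\}$ and $\mathbf d_k=\sum_{h=1}^k\ell_h(\ell_{h-1}+1)$ for $k\in\mathbb N_0$. For $\theta=(\theta_1,\dots,\theta_{\mathfrak d})\in\mathbb R^{\mathfrak d}$, $k\in\{1,\dots,L\}$, $i\in\{1,\dots,\ell_k\}$, $j\in\{1,\dots,\ell_{k-1}\}$ let $\mathfrak w^{k,\theta}_{i,j}=\theta_{(i-1)\ell_{k-1}+j+\mathbf d_{k-1}}$ and $\mathfrak b^{k,\theta}_i=\theta_{\ell_k\ell_{k-1}+i+\mathbf d_{k-1}}$, let $\mathfrak w^{k,\theta}=(\mathfrak w^{k,\theta}_{i,j})_{i,j}\in\mathbb R^{\ell_k\times\ell_{k-1}}$, $\mathfrak b^{k,\theta}=(\mathfrak b^{k,\theta}_1,\dots,\mathfrak b^{k,\theta}_{\ell_k})\in\mathbb R^{\ell_k}$, and $\mathcal A^\theta_k\colon\mathbb R^{\ell_{k-1}}\to\mathbb R^{\ell_k}$, $\mathcal A^\theta_k(x)=\mathfrak b^{k,\theta}+\mathfrak w^{k,\theta}x$. Let $\mathscr R_\infty(x)=\max\{x,0\}$ and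 let $\mathscr R_r\colon\mathbb R\to\mathbb R$, $r\in[1,\infty)$, satisfy for all $r\in[1,\infty)$: $\mathscr R_r\in C^1(\mathbb R,\mathbb R)$, $\mathscr R_r(x)=0$ for all $x\le\mathscr A r^{-1}$, $0\le\mathscr R_r(y)\le\max\{y,0\}$ for all $y\in\mathbb R$, $\mathscr R_r(z)=z$ for all $z\ge\mathscr B r^{-1}$; assume $\sup_{r\in[1,\infty)}\sup_{x\in\mathbb R}|(\mathscr R_r)'(x)|<\infty$. $\|\cdot\|$, $\langle\cdot,\cdot\rangle$ are the Euclidean norm and scalar product on each $\mathbb R^n$; for $r\in[1,\infty]$, $\mathfrak M_r(x_1,\dots,x_n)=(\mathscr R_r(x_1),\dots,\mathscr R_r(x_n))$. For $r\in[1,\infty]$, $\theta\in\mathbb R^{\mathfrak d}$ define $\mathcal N^{k,\theta}_r=(\mathcal N^{k,\theta}_{r,1},\dots,\mathcal N^{k,\theta}_{r,\ell_k})\colon\mathbb R^{\ell_0}\to\mathbb R^{\ell_k}$, $k\in\{1,\dots,L\}$, by $\mathcal N^{1,\theta}_r=\mathcal A^\theta_1$ and $\mathcal N^{k+1,\theta}_r(x)=\mathcal A^\theta_{k+1}(\mathfrak M_{r^{1/k}}(\mathcal N^{k,\theta}_r(x)))$ (with $\infty^{1/k}=\infty$). Let $\mu$ be a measure on the Borel $\sigma$-algebra of $[a,b]^{\ell_0}$ with $\mathfrak m=\mu([a,b]^{\ell_0})\in\mathbb R$, let $f=(f_1,\dots,f_{\ell_L})\colon[a,b]^{\ell_0}\to\mathbb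 R^{\ell_L}$ be measurable, and for $r\in[1,\infty]$ let $\mathcal L_r\colon\mathbb R^{\mathfrak d}\to\mathbb R$ be given by $\mathcal L_r(\theta)=\int_{[a,b]^{\ell_0}}\|\mathcal N^{L,\theta}_r(x)-f(x)\|^2\,\mu(dx)$ (these integrals are real numbers as part of the setting). Let $\mathcal G\colon\mathbb R^{\mathfrak d}\to\mathbb R^{\mathfrak d}$ satisfy $\mathcal G(\theta)=\lim_{r\to\infty}(\nabla\mathcal L_r)(\theta)$ for every $\theta$ for which $((\nabla\mathcal L_r)(\theta))_{r\in[1,\infty)}$ is convergent as $r\to\infty$. *)

(* Defs.v *)
From HB Require Import structures.
From mathcomp Require Import all_boot all_order all_algebra.
From mathcomp Require Import all_classical all_reals all_analysis.
Unset Printing Implicit Defensive.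
Import Order.TTheory GRing.Theory Num.Theory.
Import numFieldNormedType.Exports.
Local Open Scope ring_scope.
Local Open Scope classical_set_scope.

Definition enorm (R : realType) (n : nat) (v : 'rV[R]_n) : R :=
  Num.sqrt (\sum_(j < n) v 0 j ^+ 2).
Arguments enorm {R n}.

(* 0-based access to the coordinates of theta (0 outside the range). *)
Definition coord (R : realType) (d : nat) (th : 'rV[R]_d) (n : nat) : R :=
  if (insub n : option 'I_d) is Some j then th 0 j else 0.
Arguments coord {R d}.

Definition dk (l : nat -> nat) (k : nat) : nat :=
  (\sum_(1 <= h < k.+1) l h * (l h.-1 + 1))%N.

(* Weights w^{k,theta}_{i,j} = theta_{(i-1) l_{k-1} + j + d_{k-1}} (1-based i, j, theta index) *)
Definition wgt (R : realType) (l : nat -> nat) (d : nat) (th : 'rV[R]_d)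
  (k i j : nat) : R := coord th (i.-1 * l k.-1 + j.-1 + dk l k.-1)%N.
Arguments wgt {R} l {d}.

(* Biases b^{k,theta}_i = theta_{l_k l_{k-1} + i + d_{k-1}} (1-based) *)
Definition bia (R : realType) (l : nat -> nat) (d : nat) (th : 'rV[R]_d)
  (k i : nat) : R := coord th (l k * l k.-1 + i.-1 + dk l k.-1)%N.
Arguments bia {R} l {d}.

(* Realization with activation act k applied to the output of layer k
   (k >= 1).  Vectors of R^{l_k} are represented as functions nat -> R,
   with the relevant components at indices 1..l_k.
   net act th x 0 = x (the input), and for k >= 0,
   net act th x (k+1) = A_{k+1}( h_k ) with h_0 = x, h_k = M(net ... k). *)
Fixpoint net (R : realType) (l : nat -> nat) (d : nat) (act : nat -> R -> R)
  (th : 'rV[R]_d) (x : nat -> R) (k : nat) : nat -> R :=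
  match k with
  | 0 => x
  | k'.+1 => fun i => bia l th k'.+1 i +
      \sum_(1 <= j < (l k').+1) wgt l th k'.+1 i j *
        (match k' with 0 => x j | _ => act k' (net R l d act th x k' j) end)
  end.
Arguments net {R} l {d}.

Definition tin (R : realType) (n : nat) (x : n.-tuple R) : nat -> R :=
  fun j => nth 0 x j.-1.
Arguments tin {R n}.

Definition relu (R : realType) (x : R) : R := Num.max x 0.
Arguments relu {R}.

Definition netR (R : realType) (l : nat -> nat) (d : nat) (Rr : R -> R -> R)
  (r : R) (th : 'rV[R]_d) (x : (l 0).-tuple R) (k : nat) : nat -> R :=
  net l (fun k => Rr (r `^ (k%:R)^-1)) th (tin x) k.
Arguments netR {R} l {d}.

Definition netInf (R : realType) (l : nat -> nat) (d : nat)
  (th : 'rV[R]_d) (x : (l 0).-tuple R) (k : nat) : nat -> R :=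
  net l (fun _ => @relu R) th (tin x) k.
Arguments netInf {R} l {d}.

Definition sqerr (R : realType) (m : nat) (N : nat -> R) (y : m.-tuple R) : R :=
  \sum_(1 <= i < m.+1) (N i - nth 0 y i.-1) ^+ 2.
Arguments sqerr {R m}.

Definition cube (R : realType) (n : nat) (a b : R) : set (n.-tuple R) :=
  [set x | forall i : 'I_n, a <= tnth x i <= b].
Arguments cube {R} n.

Definition grad (R : realType) (d : nat) (F : 'rV[R]_d -> R) (th : 'rV[R]_d)
  : 'rV[R]_d := \row_(j < d) ('D_(delta_mx 0 j) F th).
Arguments grad {R d}.

Definition Qki (R : realType) (l : nat -> nat) (d : nat) (th : 'rV[R]_d)
  (k i : nat) : R :=
  `|bia l th k i| ^+ 2 + \sum_(1 <= j < (l k.-1).+1) `|wgt l th k i j| ^+ 2.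
Arguments Qki {R} l {d}.

Definition Qk (R : realType) (l : nat -> nat) (d : nat) (th : 'rV[R]_d)
  (k : nat) : R :=
  if k is 0 then 1 else 1 + \sum_(1 <= i < (l k).+1) Qki l th k i.
Arguments Qk {R} l {d}.

(* The sum in item (iii): over all (v_k,...,v_K) in N^{K-k+1} with
   1 <= v_w <= l_w; v_{k+w} is encoded as v w (w < K-k+1); the codomain
   bound M = max_{p <= L} l_p is large enough. *)
Definition pathsum (R : realType) (l : nat -> nat) (d : nat) (th : 'rV[R]_d)
  (L K k i : nat) : R :=
  let M := (\max_(p < L.+1) l p)%N in
  \sum_(v : {ffun 'I_(K - k).+1 -> 'I_M.+1} |
          [forall w : 'I_(K - k).+1, (1 <= v w <= l (k + w))%N])
     ((v (inord 0) == i :> nat)%:R *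
      \prod_(1 <= w < (K - k).+1)
         `|wgt l th (k + w) (v (inord w)) (v (inord w.-1))| ^+ 2).
Arguments pathsum {R} l {d}.

Definition lossR (R : realType) (l : nat -> nat) (L d : nat) (Rr : R -> R -> R)
  (mu : {measure set ((l 0).-tuple R) -> \bar R}) (a b : R)
  (f : (l 0).-tuple R -> (l L).-tuple R) (r : R) (th : 'rV[R]_d) : R :=
  Rintegral mu (cube (l 0) a b) (fun x => sqerr (netR l Rr r th x L) (f x)).
Arguments lossR {R} l L {d}.

Definition lossInf (R : realType) (l : nat -> nat) (L d : nat)
  (mu : {measure set ((l 0).-tuple R) -> \bar R}) (a b : R)
  (f : (l 0).-tuple R -> (l L).-tuple R) (th : 'rV[R]_d) : R :=
  Rintegral mu (cube (l 0) a b) (fun x => sqerr (netInf l th x L) (f x)).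
Arguments lossInf {R} l L {d}.

(* Main.v *)
(* For a fixed input, N_r^k, and with it the activation pattern
   (R_{r^{1/k}})'(N_r^k), is eventually EQUAL to its ReLU counterpart as
   r -> oo: if y > 0 then y >= B / s for s large, where R_s = id near y, and if
   y <= 0 then y < A / s, where R_s = 0 near y.  All networks and their
   parameter derivatives are bounded uniformly in r, so one may differentiate
   under the integral and pass to the limit by dominated convergence: G(theta)
   is the integral of the formal gradient of the squared error, with relu'
   replaced by the indicator of ]0, oo[.

   The bound then follows from Cauchy-Schwarz (in the measure and in the
   output index) and a bound on the squared Frobenius norm J_k of the Jacobian
   of the k-th layer,
     J_{k+1} <= l_{k+1} (1 + |h^k|^2) + |w^{k+1}|_F^2 J_k,
   where h^k is the activated k-th layer and 1 + |h^k|^2 is controlled by the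
   same induction as in (i). *)
Require Import Defs.
From HB Require Import structures.
From mathcomp Require Import all_boot all_order all_algebra.
From mathcomp Require Import all_classical all_reals all_analysis.
From mathcomp Require Import measurable_realfun zify ring lra.
Import Order.TTheory GRing.Theory Num.Theory.
Import numFieldNormedType.Exports.
Local Open Scope ring_scope.
Local Open Scope classical_set_scope.

(** * Finite sums of squares: Cauchy-Schwarz and orthogonal splitting *)

Section RealSums.
Context {R : realType}.
Implicit Types (I : Type).

(** The cross term satisfies [2uvs <= u^2 q + v^2 p], because [4 u^2 v^2 p q] is at most the square
    of the right-hand side. This is the induction step of Cauchy-Schwarz and, with [v = 1], adds a
    bias to a weighted sum. *)
Lemma sqr_add_le_mul (u v s p q : R) : 0 <= p -> 0 <= q -> s ^+ 2 <= p * q ->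
  (u * v + s) ^+ 2 <= (u ^+ 2 + p) * (v ^+ 2 + q).
Proof.
move=> p0 q0 spq; set t := u ^+ 2 * q + v ^+ 2 * p.
have t0 : 0 <= t by rewrite addr_ge0// mulr_ge0// sqr_ge0.
have : (2 * u * v * s) ^+ 2 <= t ^+ 2.
  have -> : t ^+ 2 = (u ^+ 2 * q - v ^+ 2 * p) ^+ 2
                     + (2 * u * v) ^+ 2 * (p * q) by rewrite /t; ring.
  rewrite exprMn (le_trans (ler_wpM2l (sqr_ge0 _) spq))//.
  by rewrite lerDr sqr_ge0.
rewrite -[_ <= _]ler_sqrt ?sqr_ge0// !sqrtr_sqr (ger0_norm t0) => le_t.
have := le_trans (ler_norm _) le_t; rewrite /t => {}le_t.
by rewrite sqrrD; nra.
Qed.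

Lemma CauchySchwarz_sum I (s : seq I) (F G : I -> R) :
  (\sum_(i <- s) F i * G i) ^+ 2 <=
  (\sum_(i <- s) F i ^+ 2) * (\sum_(i <- s) G i ^+ 2).
Proof.
elim: s => [|i s IH]; first by rewrite !big_nil expr0n mulr0.
rewrite !big_cons; apply: sqr_add_le_mul => //;
  by apply: sumr_ge0 => *; exact: sqr_ge0.
Qed.

Lemma sum_sqrD_orth I (s : seq I) (F G : I -> R) :
  (forall i, F i * G i = 0) ->
  \sum_(i <- s) (F i + G i) ^+ 2 =
  \sum_(i <- s) F i ^+ 2 + \sum_(i <- s) G i ^+ 2.
Proof.
move=> FG; rewrite -big_split; apply: eq_bigr => i _ /=.
by rewrite sqrrD FG mul0rn addr0.
Qed.

(** By injectivity each [j] is hit by at most one [i], so the squares produce no cross terms. Only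
    an inequality holds, since positions [g i >= d] are lost. *)
Lemma sum_sqr_delta d (I : eqType) (s : seq I) (g : I -> nat) (c : I -> R) :
  uniq s -> {in s &, injective g} ->
  \sum_(j < d) (\sum_(i <- s) (g i == j)%:R * c i) ^+ 2 <=
  \sum_(i <- s) c i ^+ 2.
Proof.
elim: s => [_ _|i s IH /andP[nis us] gi].
  by rewrite big_nil big1// => j _; rewrite big_nil expr0n.
under eq_bigr do rewrite big_cons.
rewrite big_cons sum_sqrD_orth => [|j]; last first.
  have [<-|_] := eqVneq (g i) j; last by rewrite mul0r mul0r.
  rewrite [X in _ * X]big1_seq ?mulr0// => k /andP[_ ks].
  case: eqP => [/gi ik|]; last by rewrite mul0r.
  by move: nis; rewrite -ik ?ks// !inE ?eqxx ?ks ?orbT.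
apply: lerD; last by apply: IH => // x y xs ys; apply: gi; rewrite inE ?xs ?ys orbT.
have [gid|gid] := ltnP (g i) d; last first.
  rewrite big1 ?sqr_ge0// => j _; case: eqP => [gij|]; last by rewrite mul0r expr0n.
  by have := ltn_ord j; rewrite -gij ltnNge gid.
rewrite (bigD1 (Ordinal gid))//= eqxx mul1r big1 ?addr0// => j.
by rewrite eq_sym -val_eqE => /negbTE /= ->; rewrite mul0r expr0n.
Qed.

End RealSums.

(* [vector.coord] would otherwise take precedence. *)
Local Notation coord := Defs.coord.

(** * Layout of the parameter vector, and bounds by its norm: items (ii) and (iii) *)

Section Coordinates.
Context {R : realType} {d : nat}.
Variable l : nat -> nat.
Implicit Types (th : 'rV[R]_d) (k i n : nat).

Lemma coord_ord th (j : 'I_d) : coord th j = th 0 j.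
Proof. by rewrite /coord valK. Qed.

Lemma coord_ge th n : (d <= n)%N -> coord th n = 0.
Proof. by move=> dn; rewrite /coord insubF// ltnNge dn. Qed.

Lemma enorm_sqr th : enorm th ^+ 2 = \sum_(0 <= n < d) coord th n ^+ 2.
Proof.
rewrite sqr_sqrtr ?sumr_ge0// => [|j _]; last exact: sqr_ge0.
by rewrite big_mkord; apply: eq_bigr => j _; rewrite coord_ord.
Qed.

(** The 0-based positions in [th] read by [bia] and [wgt], named so that derivatives can test which
    parameter they meet. *)
Definition bidx k i : nat := (l k * l k.-1 + i.-1 + dk l k.-1)%N.
Definition widx k i n : nat := (i.-1 * l k.-1 + n.-1 + dk l k.-1)%N.

Lemma dkS k : dk l k.+1 = (dk l k + l k.+1 * (l k + 1))%N.
Proof. by rewrite /dk big_nat_recr. Qed.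

Lemma leq_dk k m : (k <= m)%N -> (dk l k <= dk l m)%N.
Proof.
move=> /subnK <-; elim: (m - k)%N => //= n IH.
by rewrite addSn dkS (leq_trans IH) ?leq_addr.
Qed.

Lemma sum_nat_shift (F : nat -> R) m n p :
  \sum_(m <= i < n) F (i + p)%N = \sum_(m + p <= i < n + p) F i.
Proof. by rewrite big_addn addnK. Qed.

Lemma sum_rows (F : nat -> R) m n :
  \sum_(0 <= i < m * n) F i = \sum_(0 <= i < m) \sum_(0 <= j < n) F (i * n + j)%N.
Proof.
elim: m => [|m IH]; first by rewrite mul0n !big_geq.
rewrite big_nat_recr//= -IH mulSn addnC (@big_cat_nat _ _ _ (m * n)) ?leq_addr//=.
congr (_ + _); rewrite -{1}(add0n (m * n)%N) [X in \sum_(_ <= _ < X) _]addnC.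
by rewrite -sum_nat_shift; apply: eq_bigr => i _; rewrite addnC.
Qed.

(** The block of a layer stores its weight matrix row by row, followed by its biases. *)
Lemma sum_layer (F : nat -> R) k :
  \sum_(dk l k <= n < dk l k.+1) F n =
  \sum_(1 <= i < (l k.+1).+1)
    (F (bidx k.+1 i) + \sum_(1 <= j < (l k).+1) F (widx k.+1 i j)).
Proof.
rewrite big_split /= big_add1 /=.
under [X in _ = _ + X]eq_bigr do rewrite big_add1 /=.
rewrite [X in _ = _ + X]big_add1 /= /bidx /widx /=.
rewrite -(sum_rows (fun n => F (n + dk l k)%N)) sum_nat_shift add0n.
rewrite [X in _ = X + _](_ : _ =
  \sum_(0 <= i < l k.+1) F (i + (l k.+1 * l k + dk l k))%N); last first.
  by apply: eq_bigr => i _; congr F; lia.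
rewrite sum_nat_shift add0n [RHS]addrC.
rewrite -[X in \sum_(X <= _ < _) _]add0n dkS mulnDr muln1.
rewrite (_ : (_ + (l k.+1 * l k + l k.+1) = l k.+1 + (l k.+1 * l k + dk l k))%N); last lia.
by rewrite add0n (@big_cat_nat _ _ _ (l k.+1 * l k + dk l k)) ?leq_addl.
Qed.

Lemma sum_Qki th k :
  \sum_(1 <= i < (l k.+1).+1) Qki l th k.+1 i =
  \sum_(dk l k <= n < dk l k.+1) coord th n ^+ 2.
Proof.
rewrite (sum_layer (fun n => coord th n ^+ 2)).
apply: eq_bigr => i _; rewrite /Qki /bia /wgt real_normK ?num_real//.
by congr (_ + _); apply: eq_bigr => j _; rewrite real_normK ?num_real.
Qed.

Lemma Qki_ge0 th k i : 0 <= Qki l th k i.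
Proof. by rewrite /Qki addr_ge0 ?sumr_ge0 ?exprn_ge0// => *; rewrite exprn_ge0. Qed.

Lemma Qk_ge1 th k : 1 <= Qk l th k.
Proof. by case: k => // k; rewrite /Qk lerDl sumr_ge0// => *; exact: Qki_ge0. Qed.

Section Norm.
Variables (L : nat) (th : 'rV[R]_d).
Hypothesis hd : d = dk l L.

(** The left side is the sum of squares over one contiguous block of coordinates, which lies inside
    [th] because [d = dk l L]. *)
Lemma sum_Qki_le k : (k < L)%N ->
  \sum_(1 <= i < (l k.+1).+1) Qki l th k.+1 i <= enorm th ^+ 2.
Proof.
move=> kL; rewrite sum_Qki enorm_sqr.
have kd : (dk l k.+1 <= d)%N by rewrite {1}hd leq_dk.
have kk : (dk l k <= dk l k.+1)%N by rewrite leq_dk.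
rewrite (@big_cat_nat _ _ _ (dk l k) 0 d) ?(leq_trans kk)//=.
rewrite (@big_cat_nat _ _ _ (dk l k.+1) (dk l k) d)//=.
rewrite addrCA lerDl addr_ge0// sumr_ge0// => *; exact: sqr_ge0.
Qed.

Lemma Qk_le k : (k < L)%N -> Qk l th k.+1 <= enorm th ^+ 2 + 1.
Proof. by move=> kL; rewrite /Qk addrC lerD2r sum_Qki_le. Qed.

(** The exponent is [K] although there are [K + 1] factors, since the factor at [p = 0] equals 1. *)
Lemma prod_Qk_le K : (K <= L)%N ->
  \prod_(0 <= p < K.+1) Qk l th p <= (enorm th ^+ 2 + 1) ^+ K.
Proof.
elim: K => [|K IH] KL; first by rewrite big_nat1.
rewrite big_nat_recr//= exprSr ler_pM//.
- by apply: prodr_ge0 => p _; exact: le_trans (Qk_ge1 _ _).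
- exact: le_trans (Qk_ge1 _ K.+1).
- exact/IH/ltnW.
- exact: Qk_le.
Qed.

Lemma sum_wgt_sqr_le k : (k < L)%N ->
  \sum_(1 <= i < (l k.+1).+1) \sum_(1 <= j < (l k).+1) wgt l th k.+1 i j ^+ 2
  <= enorm th ^+ 2.
Proof.
move=> kL; apply: le_trans (sum_Qki_le k kL); apply: ler_sum => i _.
rewrite /Qki /= -[leLHS]add0r lerD ?exprn_ge0//.
by apply: ler_sum => j _; rewrite real_normK ?num_real.
Qed.

(* Each factor is enlarged by summing over its second index, which decouples
   the factors and turns the sum over paths into a product of sums. *)
Lemma pathsum_le K k i : (K <= L)%N -> (1 <= k <= K)%N -> (1 <= i <= l k)%N ->
  pathsum l th L K k i <= enorm th ^+ (2 * (K - k)).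
Proof.
move=> KL /andP[k0 kK] /andP[i0 il]; rewrite /pathsum.
set M := (\max_(p < L.+1) l p)%N; set n := (K - k)%N.
have leM p : (p <= L)%N -> (l p <= M)%N.
  by move=> pL; have := @leq_bigmax _ (fun p : 'I_L.+1 => l p) (Ordinal (pL : (p < L.+1)%N)).
pose c (w : nat) (v : 'I_M.+1) : R :=
  \sum_(1 <= u < (l (k + w).-1).+1) wgt l th (k + w) v u ^+ 2.
(* Factor 0 carries the indicator of the start [i]; the other factors no longer involve the previous
   vertex of the path. *)
pose F (w : 'I_n.+1) (v : 'I_M.+1) : R :=
  if w == ord0 then (v == i :> nat)%:R else c w v.
pose P (w : 'I_n.+1) : pred 'I_M.+1 := [pred v : 'I_M.+1 | (1 <= v <= l (k + w))%N].
have c0 w v : 0 <= c w v by apply: sumr_ge0 => *; exact: sqr_ge0.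
apply: (@le_trans _ _ (\sum_(v in family P) \prod_w F w (v w))).
  rewrite [leLHS](eq_bigl (mem (family P))); last first.
    by move=> v; apply/forallP/familyP => [h w|h w]; have := h w.
  apply: ler_sum => v /familyP vP.
  rewrite big_ord_recl /F eqxx (_ : inord 0 = ord0); last first.
    by apply: val_inj; rewrite /= inordK.
  apply: ler_wpM2l; first exact: ler0n.
  rewrite big_add1 /= big_mkord; apply: ler_prod => w _.
  rewrite exprn_ge0//= (_ : inord w.+1 = lift ord0 w); last first.
    by apply: val_inj; rewrite /= inordK// ltnS.
  rewrite real_normK ?num_real// /c.
  have /andP[v1 vl] : (1 <= v (inord w) <= l (k + w))%N.
    have wn : (w < n.+1)%N by rewrite ltnS ltnW.
    by have := vP (inord w); rewrite inE /P /= inordK.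
  rewrite /bump /= add1n addnS /= (bigD1_seq (v (inord w) : nat)) ?iota_uniq//=; last first.
    by rewrite mem_index_iota ltnS v1.
  by rewrite lerDl sumr_ge0// => *; exact: sqr_ge0.
(* Distributivity: each factor depends on one coordinate of the path only. *)
have -> : \sum_(v in family P) \prod_w F w (v w) = \prod_w \sum_(v | P w v) F w v.
  by rewrite bigA_distr_big_dep.
have iM : (i < M.+1)%N by rewrite ltnS (leq_trans il)// leM// (leq_trans kK).
(* Only the vertex [i] survives in factor 0; each of the remaining [n] factors is the squared norm
   of one weight matrix. *)
rewrite big_ord_recl [X in X * _](_ : _ = 1) ?mul1r; last first.
  rewrite (bigD1 (Ordinal iM)) /P /= ?addn0 ?i0//.
  rewrite /F eqxx eqxx big1 ?addr0// => v /andP[_].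
  by rewrite -val_eqE /= => /negbTE ->.
rewrite exprM -[n in leRHS]card_ord -prodr_const; apply: ler_prod => w _.
rewrite sumr_ge0//= => [|v _]; last exact: c0.
have kwL : (k + w < L)%N by rewrite (leq_trans _ KL)// -ltn_subRL.
apply: le_trans (sum_wgt_sqr_le _ kwL).
have lM := leM _ kwL.
rewrite /P /F /c /= /bump /= add1n addnS /=.
rewrite [leRHS](big_nat_widen _ _ M.+1) ?ltnS//= big_add1 /=.
rewrite big_mkcond big_ord_recl /= add0r big_mkord [leRHS]big_mkcond /=.
by apply: ler_sum => v _; rewrite /bump /= add1n ltnS.
Qed.
End Norm.
End Coordinates.

(** * Layer bounds and the Jacobian *)

Section Realization.
Context {R : realType} {d : nat}.
Variable l : nat -> nat.
Implicit Types (th : 'rV[R]_d) (act dact : nat -> R -> R) (x : nat -> R).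
Implicit Types (k i j n : nat).

(** What layer [k + 1] receives: the raw input for [k = 0], the activated layer otherwise. This
    makes [netS] uniform in [k]. *)
Definition hid act th x k i : R :=
  if k is 0 then x i else act k (net l act th x k i).

Lemma netS act th x k i : net l act th x k.+1 i =
  bia l th k.+1 i + \sum_(1 <= n < (l k).+1) wgt l th k.+1 i n * hid act th x k n.
Proof. by case: k. Qed.

(* Formal partial derivative of the i-th component of the k-th layer with
   respect to the j-th coordinate of theta (0-based), when [dact] stands for
   the derivative of [act]. *)
Fixpoint dnet act dact th j x k : nat -> R :=
  if k is k'.+1 then fun i =>
    (bidx l k i == j)%:R +
    \sum_(1 <= n < (l k').+1)
      ((widx l k i n == j)%:R * hid act th x k' n +
       wgt l th k i n *
         (dact k' (net l act th x k' n) * dnet act dact th j x k' n))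
  else fun=> 0.

(** The summand 1 is the constant input multiplied by the bias. *)
Definition hsq act th x k : R := 1 + \sum_(1 <= n < (l k).+1) hid act th x k n ^+ 2.

Lemma sum_const_1n (z : R) n : \sum_(1 <= i < n.+1) z = n%:R * z.
Proof. by rewrite sumr_const_nat subSS subn0 mulr_natl. Qed.

Section Bounds.
Variables (act dact : nat -> R -> R) (th : 'rV[R]_d) (x : nat -> R) (c : R).
Hypothesis c1 : 1 <= c.
Hypothesis xc : forall i, `|x i| <= c.
Hypothesis act_le : forall k y, `|act k y| <= `|y|.

(** Cauchy-Schwarz for the row (bias, weights) against the vector (1, hidden layer). *)
Lemma sqr_net_le_hsq k i :
  `|net l act th x k.+1 i| ^+ 2 <= Qki l th k.+1 i * hsq act th x k.
Proof.
rewrite real_normK ?num_real// netS /Qki /hsq real_normK ?num_real//.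
under [in leRHS]eq_bigr do rewrite real_normK ?num_real//.
rewrite -[bia _ _ _ _ in leLHS]mulr1 -[1 in leRHS](expr1n R 2).
apply: sqr_add_le_mul; [| |exact: CauchySchwarz_sum];
  by apply: sumr_ge0 => *; exact: sqr_ge0.
Qed.

Lemma hid_le k i : `|hid act th x k.+1 i| ^+ 2 <= `|net l act th x k.+1 i| ^+ 2.
Proof. by rewrite /hid lerXn2r ?nnegrE. Qed.

Definition wprod k : R := \prod_(0 <= p < k) (((l p)%:R + 1) * Qk l th p).

Lemma wprodS k : wprod k.+1 = wprod k * (((l k)%:R + 1) * Qk l th k).
Proof. by rewrite /wprod big_nat_recr. Qed.

Lemma wprod_ge1 k : 1 <= wprod k.
Proof.
rewrite /wprod; elim/big_ind : _ => // [u v u1 v1|p _]; rewrite -[1]mulr1 ler_pM//.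
  by rewrite mulr1 lerDr.
exact: Qk_ge1.
Qed.

Lemma wprod_ge0 k : 0 <= wprod k.
Proof. exact: le_trans (wprod_ge1 k). Qed.

(** Induction on layers: summing [sqr_net_le_hsq] over the units turns the [Qki] into [Qk], and the
    1 in [Qk] absorbs the 1 in [hsq]. The width is needed for the input layer; later layers insert
    it at the end of the step. *)
Lemma hsq_le k : hsq act th x k <= c ^+ 2 * wprod k.+1.
Proof.
have c2 : 1 <= c ^+ 2 by rewrite exprn_ege1.
elim: k => [|k IH].
  rewrite /hsq /wprod big_nat1 /= mulr1 mulrDr mulr1 addrC lerD//.
  rewrite mulrC -sum_const_1n.
  apply: ler_sum => i _.
  by rewrite -real_normK ?num_real// lerXn2r ?nnegrE ?(le_trans _ (xc i)).
apply: (@le_trans _ _ (c ^+ 2 * wprod k.+1 * Qk l th k.+1)).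
  rewrite /hsq /Qk mulrDr mulr1 lerD//.
    by rewrite -[1]mulr1 ler_pM// wprod_ge1.
  rewrite mulr_sumr; apply: ler_sum => i _; rewrite -real_normK ?num_real//.
  apply: le_trans (hid_le _ _) _; apply: le_trans (sqr_net_le_hsq _ _) _.
  by rewrite mulrC ler_wpM2r ?Qki_ge0.
rewrite (wprodS k.+1) -[leLHS]mulrA; apply: ler_wpM2l; first exact: sqr_ge0.
apply: ler_wpM2l; first exact: wprod_ge0.
rewrite ler_peMl// ?lerDr//; exact: le_trans (Qk_ge1 _ _ _).
Qed.

Lemma sqr_net_le k i :
  `|net l act th x k.+1 i| ^+ 2 <= c ^+ 2 * Qki l th k.+1 i * wprod k.+1.
Proof.
apply: le_trans (sqr_net_le_hsq _ _) _.
rewrite mulrAC [leRHS]mulrC; apply: ler_wpM2l; [exact: Qki_ge0|exact: hsq_le].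
Qed.

Section Jacobian.
Variable L : nat.
Hypothesis hd : d = dk l L.
Hypothesis dact_le1 : forall k y, `|dact k y| <= 1.

Lemma widx_lt_bidx k i n : (0 < i <= l k)%N -> (0 < n <= l k.-1)%N ->
  (widx l k i n < bidx l k i)%N.
Proof.
move=> /andP[i0 il] /andP[n0 nl]; rewrite /widx /bidx ltn_add2r.
have h : (i * l k.-1 <= l k * l k.-1)%N by rewrite leq_mul2r il orbT.
rewrite (leq_trans _ (leq_addr _ _))// (leq_trans _ h)//.
by case: i i0 {il h} => // i _; rewrite mulSn addnC ltn_add2r prednK.
Qed.

Lemma bidx_lt_dk k i : (0 < i <= l k.+1)%N -> (bidx l k.+1 i < dk l k.+1)%N.
Proof. by move=> /andP[i0 il]; rewrite dkS /bidx /=; lia. Qed.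

Lemma dk_le_widx k i n : (dk l k <= widx l k.+1 i n)%N.
Proof. exact: leq_addl. Qed.

Lemma dk_le_bidx k i : (dk l k <= bidx l k.+1 i)%N.
Proof. exact: leq_addl. Qed.

(** Such a [j] belongs to a later layer, on which layer [k] does not depend. *)
Lemma dnet_eq0 k i j : (dk l k <= j)%N -> (0 < i <= l k)%N ->
  dnet act dact th j x k i = 0.
Proof.
elim: k i => //= k IH i kj il.
have lk : (dk l k <= j)%N by rewrite (leq_trans _ kj)// leq_dk.
have bj := leq_trans (bidx_lt_dk _ _ il) kj.
rewrite ltn_eqF// add0r big_nat big1// => n nl.
by rewrite IH// !mulr0 addr0 ltn_eqF ?mul0r// (ltn_trans _ bj)// widx_lt_bidx.
Qed.

(** Squared Frobenius norm of the formal Jacobian of layer [k] with respect to [th]. *)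
Definition jac k : R :=
  \sum_(1 <= i < (l k).+1) \sum_(j < d) dnet act dact th j x k i ^+ 2.

(** The contribution of the parameters of layer [k + 1] themselves; [dnet_chain] is the contribution
    passing through layer [k]. *)
Definition dnet_direct j k i : R := (bidx l k.+1 i == j)%:R +
  \sum_(1 <= n < (l k).+1) (widx l k.+1 i n == j)%:R * hid act th x k n.

Definition dnet_chain j k i : R :=
  \sum_(1 <= n < (l k).+1) wgt l th k.+1 i n *
     (dact k (net l act th x k n) * dnet act dact th j x k n).

Lemma dnetS j k i :
  dnet act dact th j x k.+1 i = dnet_direct j k i + dnet_chain j k i.
Proof. by rewrite /dnet_direct /dnet_chain /= big_split addrA. Qed.

(** The threshold [dk l k] separates the two: from it on the chain part vanishes by [dnet_eq0],
    below it no index of layer [k + 1] is met. *)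
Lemma dnet_direct_chain0 j k i : dnet_direct j k i * dnet_chain j k i = 0.
Proof.
have [kj|jk] := leqP (dk l k) j; last first.
  rewrite [X in X * _](_ : _ = 0) ?mul0r// /dnet_direct.
  rewrite gtn_eqF ?add0r ?(leq_trans jk) ?dk_le_bidx//.
  by apply: big1 => n _; rewrite gtn_eqF ?mul0r ?(leq_trans jk) ?dk_le_widx.
rewrite [X in _ * X](_ : _ = 0) ?mulr0// /dnet_chain.
by rewrite big_nat big1// => n nl; rewrite dnet_eq0// !mulr0.
Qed.

Lemma dnet_direct_le k i : (0 < i <= l k.+1)%N ->
  \sum_(j < d) dnet_direct j k i ^+ 2 <= hsq act th x k.
Proof.
move=> il.
(* Index 0 stands for the bias, with derivative 1, so that bias and weights form one family with
   distinct positions. *)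
pose g n := if n == 0 then bidx l k.+1 i else widx l k.+1 i n.
pose h n : R := if n == 0 then 1 else hid act th x k n.
rewrite /hsq -[1](expr1n R 2) [leRHS](_ : _ = \sum_(0 <= n < (l k).+1) h n ^+ 2); last first.
  by rewrite [RHS]big_ltn//; congr (_ + _); apply: eq_big_nat => -[].
rewrite [leLHS](_ : _ = \sum_(j < d)
  (\sum_(0 <= n < (l k).+1) (g n == j)%:R * h n) ^+ 2); last first.
  apply: eq_bigr => j _; rewrite /dnet_direct [in RHS]big_ltn// mulr1.
  by congr ((_ + _) ^+ 2); apply: eq_big_nat => -[].
apply: sum_sqr_delta; first exact: iota_uniq.
move=> m n; rewrite !mem_index_iota /= !ltnS /g => ml nl.
case: m ml => [|m] ml; case: n nl => [|n] nl //=.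
- by move=> e; have := widx_lt_bidx k.+1 i n.+1 il nl; rewrite -e ltnn.
- by move=> e; have := widx_lt_bidx k.+1 i m.+1 il ml; rewrite e ltnn.
- by rewrite /widx /= => e; lia.
Qed.

Lemma dnet_chain_le j k i : dnet_chain j k i ^+ 2 <=
  (\sum_(1 <= n < (l k).+1) wgt l th k.+1 i n ^+ 2) *
  (\sum_(1 <= n < (l k).+1) dnet act dact th j x k n ^+ 2).
Proof.
apply: le_trans (CauchySchwarz_sum _ _ _ _) _.
apply: ler_wpM2l; first by apply: sumr_ge0 => *; exact: sqr_ge0.
apply: ler_sum => n _; rewrite exprMn ler_piMl ?sqr_ge0//.
by rewrite -real_normK ?num_real// exprn_ile1.
Qed.

(* A parameter feeds layer k+1 either directly or through layer k, never both,
   so the squared Jacobian splits without cross terms. *)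
Lemma jacS_le k : (k < L)%N ->
  jac k.+1 <= (l k.+1)%:R * hsq act th x k + enorm th ^+ 2 * jac k.
Proof.
move=> kL; rewrite /jac.
under eq_bigr => i _.
  under eq_bigr do rewrite dnetS.
  rewrite sum_sqrD_orth; last by move=> j; exact: dnet_direct_chain0.
  over.
rewrite big_split lerD//=.
  rewrite -sum_const_1n.
  by rewrite big_nat [leRHS]big_nat; apply: ler_sum => i il; exact: dnet_direct_le.
apply: le_trans (ler_wpM2r _ (sum_wgt_sqr_le l L th hd k kL)); last first.
  by do 2 (apply: sumr_ge0 => ? _); exact: sqr_ge0.
rewrite mulr_suml; apply: ler_sum => i _.
rewrite [X in _ * X]exchange_big /= mulr_sumr.
by apply: ler_sum => j _; exact: dnet_chain_le.
Qed.

(** The recursion [jacS_le] is unrolled. Every layer adds one direct term bounded by the same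
    expression, whence the factor [k + 1]. *)
Lemma jac_le k : (k < L)%N ->
  jac k.+1 <= k.+1%:R * c ^+ 2 * (\prod_(0 <= p < k.+2) ((l p)%:R + 1))
              * (enorm th ^+ 2 + 1) ^+ k.
Proof.
pose V n : R := \prod_(0 <= p < n) ((l p)%:R + 1).
set T := enorm th ^+ 2 + 1.
have T1 : 1 <= T by rewrite lerDr sqr_ge0.
have V0 n : 0 <= V n by apply: prodr_ge0 => *; rewrite addr_ge0.
have T0 n : 0 <= T ^+ n by rewrite exprn_ge0// (le_trans _ T1).
(* Item (ii) bounds the product of the [Qk] inside [hsq_le] by [T ^+ n]. *)
have direct n : (n < L)%N ->
    (l n.+1)%:R * hsq act th x n <= c ^+ 2 * V n.+2 * T ^+ n.
  move=> nL; apply: (@le_trans _ _ (((l n.+1)%:R + 1) * (c ^+ 2 * (V n.+1 * T ^+ n)))).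
    apply: ler_pM => //.
    - by rewrite addr_ge0// sumr_ge0// => *; exact: sqr_ge0.
    - by rewrite lerDl.
    - apply: le_trans (hsq_le n) _; apply: ler_wpM2l; first exact: sqr_ge0.
      rewrite /wprod big_split; apply: ler_wpM2l; first exact: V0.
      by apply: prod_Qk_le hd _ _; exact: ltnW.
  by rewrite le_eqVlt; apply/orP; left; apply/eqP; rewrite /V [in RHS]big_nat_recr//=; ring.
elim: k => [|k IH] kL.
  apply: le_trans (jacS_le _ kL) _.
  rewrite [jac 0]big1 ?mulr0 ?addr0 ?mul1r => [|i _]; first exact: direct.
  by rewrite big1// => j _; rewrite expr0n.
(* The squared norm costs one more power of [T], and one more factor of [V], at least 1, aligns this
   term with the direct one. *)
have chain : enorm th ^+ 2 * jac k.+1 <= T * (k.+1%:R * c ^+ 2 * V k.+3 * T ^+ k).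
  apply: ler_pM; [exact: sqr_ge0| |by rewrite lerDl|].
    by do 2 (apply: sumr_ge0 => ? _); exact: sqr_ge0.
  apply: le_trans (IH (ltnW kL)) _; apply: ler_wpM2r; first exact: T0.
  apply: ler_wpM2l; first by rewrite mulr_ge0 ?sqr_ge0.
  by rewrite /V [leRHS]big_nat_recr//= ler_peMr ?lerDr//; exact: V0.
apply: le_trans (jacS_le _ kL) _; apply: le_trans (lerD (direct _ kL) chain) _.
rewrite -/(V k.+3) -[k.+2%:R]natr1 (exprS T) le_eqVlt; apply/orP; left; apply/eqP.
ring.
Qed.

End Jacobian.
End Bounds.
End Realization.

(** * Differentiability and the limit of the activations *)

Section Differentiability.
Context {R : realType} {d : nat}.
Variable l : nat -> nat.

Lemma coord_shift (th : 'rV[R]_d) (j : 'I_d) (h : R) (n : nat) :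
  coord (th + h *: delta_mx 0 j) n = coord th n + h * (n == j)%:R.
Proof.
have [nd|nd] := ltnP n d; last first.
  by rewrite !coord_ge// gtn_eqF ?(leq_trans _ nd)// mulr0 addr0.
rewrite -[n]/(nat_of_ord (Ordinal nd)) !coord_ord !mxE eqxx /=.
by rewrite -val_eqE.
Qed.

Lemma is_derive_coord (th : 'rV[R]_d) (j : 'I_d) (h : R) (n : nat) :
  is_derive h (1 : R) (fun s => coord (th + s *: delta_mx 0 j) n) (n == j)%:R.
Proof.
under eq_fun do rewrite coord_shift.
have -> : (fun s : R => coord th n + s * (n == j)%:R) =
    cst (coord th n) + ((n == j)%:R : R) *: (id : R -> R).
  by apply/funext => s /=; rewrite mulrC.
by apply: is_derive_eq; rewrite add0r [_ *: _]mulr1.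
Qed.

Lemma is_derive_bigsum (I : Type) (s : seq I) (F : I -> R -> R) (dF : I -> R) (x : R) :
  (forall i, is_derive x (1 : R) (F i) (dF i)) ->
  is_derive x (1 : R) (fun y => \sum_(i <- s) F i y) (\sum_(i <- s) dF i).
Proof.
move=> FdF; elim: s => [|i s IH].
  rewrite big_nil; under eq_fun do rewrite big_nil; exact: is_derive_cst.
rewrite big_cons; under eq_fun do rewrite big_cons; exact: is_deriveD.
Qed.

Lemma is_derive_mul (f g : R -> R) (x df dg : R) :
  is_derive x (1 : R) f df -> is_derive x (1 : R) g dg ->
  is_derive x (1 : R) (fun y => f y * g y) (df * g x + f x * dg).
Proof.
move=> fdf gdg; rewrite addrC [df * _]mulrC; exact: is_deriveM.
Qed.

Section Fixed.
Variables (act dact : nat -> R -> R) (th : 'rV[R]_d) (j : 'I_d) (x : nat -> R).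
Hypothesis act_dact : forall k y, is_derive y (1 : R) (act k) (dact k y).
Local Notation th_ h := (th + h *: delta_mx 0 j).

Lemma is_derive_net k i (h : R) :
  is_derive h (1 : R) (fun s => net l act (th_ s) x k i)
    (dnet l act dact (th_ h) j x k i).
Proof.
elim: k i => [|k IH] i; first exact: is_derive_cst.
under eq_fun do rewrite netS.
apply: is_deriveD; first exact: is_derive_coord.
apply: is_derive_bigsum => n; apply: is_derive_mul; first exact: is_derive_coord.
(* The input does not depend on the parameters and carries no activation. *)
case: k IH => [|k] IH; first by rewrite mulr0; exact: is_derive_cst.
exact: is_derive1_comp.
Qed.

End Fixed.

(** * Bounds uniform over activations, bounded parameters and bounded inputs *)

Section UniformBounds.
Variables (M D : R).
Hypothesis M0 : 0 <= M.
Hypothesis D0 : 0 <= D.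

(** [C] is chosen before the activation, the parameter and the input, so one constant serves all [r]
    and a whole segment of parameters. *)
Lemma net_bounded k : exists2 C : R, 0 <= C &
  forall (act : nat -> R -> R) (th : 'rV[R]_d) x i,
    (forall k y, `|act k y| <= `|y|) -> (forall n, `|coord th n| <= M) ->
    (forall n, `|x n| <= M) -> `|net l act th x k i| <= C.
Proof.
elim: k => [|k [C C0 IH]]; first by exists M => // act th x i _ _; exact.
exists (M + (l k)%:R * (M * Num.max M C)).
  by rewrite addr_ge0// !mulr_ge0// le_max M0.
move=> act th x i act_le thM xM; rewrite netS.
apply: le_trans (ler_normD _ _) _; apply: lerD; first exact: thM.
apply: le_trans (ler_norm_sum _ _ _) _; rewrite -sum_const_1n.
apply: ler_sum => n _; rewrite normrM ler_pM//; first exact: thM.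
case: k IH => [|k] IH; first by rewrite le_max xM.
rewrite le_max; apply/orP; right; apply: le_trans (act_le _ _) _; exact: IH.
Qed.

Lemma hid_bounded k : exists2 C : R, 0 <= C &
  forall (act : nat -> R -> R) (th : 'rV[R]_d) x i,
    (forall k y, `|act k y| <= `|y|) -> (forall n, `|coord th n| <= M) ->
    (forall n, `|x n| <= M) -> `|hid l act th x k i| <= C.
Proof.
case: k => [|k]; first by exists M => // act th x i _ _; exact.
have [C C0 HC] := net_bounded k.+1; exists C => // act th x i act_le thM xM.
by apply: le_trans (act_le _ _) _; exact: HC.
Qed.

Lemma dnet_bounded k : exists2 C : R, 0 <= C &
  forall (act dact : nat -> R -> R) (th : 'rV[R]_d) x j i,
    (forall k y, `|act k y| <= `|y|) -> (forall k y, `|dact k y| <= D) ->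
    (forall n, `|coord th n| <= M) ->
    (forall n, `|x n| <= M) -> `|dnet l act dact th j x k i| <= C.
Proof.
elim: k => [|k [C C0 IH]]; first by exists 0 => // *; rewrite normr0.
have [H H0 HH] := hid_bounded k.
exists (1 + (l k)%:R * (H + M * (D * C))).
  by rewrite addr_ge0// mulr_ge0// addr_ge0// !mulr_ge0.
move=> act dact th x j i act_le dact_le thM xM /=.
have b1 (b : bool) : `|b%:R : R| <= 1 by case: b; rewrite ?normr1 ?normr0.
apply: le_trans (ler_normD _ _) _; apply: lerD => //.
apply: le_trans (ler_norm_sum _ _ _) _; rewrite -sum_const_1n.
apply: ler_sum => n _; apply: le_trans (ler_normD _ _) _; apply: lerD.
  by rewrite normrM -[H]mul1r ler_pM//; exact: HH.
by rewrite !normrM !ler_pM ?mulr_ge0//; [exact: thM|exact: IH].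
Qed.

End UniformBounds.

Section Measurability.
Variables (act dact : nat -> R -> R) (th : 'rV[R]_d).
Hypothesis mact : forall k, measurable_fun setT (act k).
Hypothesis mdact : forall k, measurable_fun setT (dact k).

Lemma measurable_tin n j : measurable_fun setT (fun x : n.-tuple R => tin x j).
Proof.
have [jn|jn] := ltnP j.-1 n; last first.
  rewrite (_ : (fun _ => _) = cst 0)//.
  by apply/funext => x; rewrite /tin nth_default ?size_tuple.
rewrite (_ : (fun _ => _) = (fun x => tnth x (Ordinal jn))); first exact: measurable_tnth.
by apply/funext => x; rewrite /tin (tnth_nth 0).
Qed.

Lemma measurable_net k i :
  measurable_fun setT (fun x : (l 0).-tuple R => net l act th (tin x) k i).
Proof.
elim: k i => [|k IH] i; first exact: measurable_tin.
under eq_fun do rewrite netS.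
apply: measurable_funD => //; apply: measurable_sum => n.
apply: measurable_funM => //; case: k IH => [|k] IH; first exact: measurable_tin.
exact: measurableT_comp (mact _) (IH n).
Qed.

Lemma measurable_hid k i :
  measurable_fun setT (fun x : (l 0).-tuple R => hid l act th (tin x) k i).
Proof.
case: k => [|k]; first exact: measurable_tin.
exact: measurableT_comp (mact _) (measurable_net _ _).
Qed.

Lemma measurable_dnet j k i :
  measurable_fun setT (fun x : (l 0).-tuple R => dnet l act dact th j (tin x) k i).
Proof.
elim: k i => [|k IH] i //=.
apply: measurable_funD => //; apply: measurable_sum => n.
apply: measurable_funD; apply: measurable_funM => //.
  exact: measurable_hid.
by apply: measurable_funM => //; exact: measurableT_comp (mdact _) (measurable_net _ _).
Qed.

End Measurability.
End Differentiability.

Section Limit.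
Context {R : realType} {d : nat}.
Variables (l : nat -> nat) (A B : R) (Rr : R -> R -> R).
Hypothesis hA : 0 < A.
Hypothesis hRr0 : forall r x, 1 <= r -> x <= A * r^-1 -> Rr r x = 0.
Hypothesis hRrid : forall r x, 1 <= r -> B * r^-1 <= x -> Rr r x = x.

Lemma ge1_powR (r p : R) : 1 <= r -> 0 <= p -> 1 <= r `^ p.
Proof. by move=> r1 p0; rewrite -[1](powRr0 r) ler_powR. Qed.

(** It suffices that [r] exceeds the [k]-th power of [|K|]. For [k = 0] the exponent is 0 by
    convention and the power stays 1. *)
Lemma near_root_ge k (K : R) : (0 < k)%N ->
  \forall r \near +oo, 1 <= r /\ K <= r `^ (k%:R)^-1.
Proof.
move=> k0; near=> r.
have r1 : 1 <= r by near: r; exact: nbhs_pinfty_ge.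
have rK : `|K| ^+ k <= r by near: r; exact: nbhs_pinfty_ge.
split => //; rewrite (le_trans (ler_norm K))//.
have -> : `|K| = (`|K| ^+ k) `^ (k%:R)^-1.
  by rewrite -powR_mulrn// -powRrM mulfV ?powRr1// pnatr_eq0 -lt0n.
by apply: ge0_ler_powR; rewrite ?nnegrE ?invr_ge0 ?exprn_ge0// (le_trans _ r1).
Unshelve. all: by end_near. Qed.

(** The point [y = 0] falls strictly inside the flat region, so the limit derivative at the kink of
    ReLU is 0. *)
Lemma near_Rr k (y : R) : (0 < k)%N -> \forall r \near +oo,
  Rr (r `^ (k%:R)^-1) y = relu y /\
  (Rr (r `^ (k%:R)^-1))^`() y = (0 < y)%R%:R.
Proof.
move=> k0; have [y0|y0] := ltP 0 y.
  (* The extra 1 makes [B / s < y] strict, leaving a neighbourhood of [y] on which [Rr s] is the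
     identity. *)
  near=> r; have [r1 Kr] : 1 <= r /\ (`|B| + 1) / y <= r `^ (k%:R)^-1.
    by near: r; exact: near_root_ge.
  set s := r `^ _ in Kr *; have s1 : 1 <= s by rewrite ge1_powR ?invr_ge0.
  have s0 : 0 < s by rewrite (lt_le_trans _ s1).
  have Bs : B * s^-1 < y.
    rewrite ltr_pdivrMr// mulrC -ltr_pdivrMr//.
    by rewrite (lt_le_trans _ Kr)// ltr_pM2r ?invr_gt0// ltr_pwDr// ler_norm.
  have near_id : {near y, Rr s =1 id}.
    by apply: filterS (lt_nbhsr Bs) => z /ltW; exact: hRrid.
  split; first by rewrite hRrid ?(ltW Bs)// /relu max_l// ltW.
  by rewrite derive1E (near_eq_derive _ near_id) ?derive_id//.
near=> r; have [r1 _] : 1 <= r /\ 0 <= r `^ (k%:R)^-1.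
  by near: r; exact: near_root_ge.
set s := r `^ _; have s1 : 1 <= s by rewrite ge1_powR ?invr_ge0.
have As : y < A * s^-1 by rewrite (le_lt_trans y0)// divr_gt0// (lt_le_trans _ s1).
have near_0 : {near y, Rr s =1 cst 0}.
  by apply: filterS (lt_nbhsl As) => z /ltW; exact: hRr0.
split; first by rewrite hRr0 ?(ltW As)// /relu max_r.
by rewrite derive1E (near_eq_derive _ near_0) ?derive_cst//.
Unshelve. all: by end_near. Qed.

Lemma near_forall_lt (F : set_system R) {FF : Filter F} (P : nat -> R -> Prop) N :
  (forall n, \forall r \near F, P n r) ->
  \forall r \near F, forall n, (n < N)%N -> P n r.
Proof.
move=> PF; elim: N => [|N IH]; first exact: nearW.
near=> r => n; rewrite ltnS leq_eqVlt => /orP[/eqP->|nN].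
  by near: r; exact: PF.
by move: n nN; near: r; exact: IH.
Unshelve. all: by end_near. Qed.

Definition actR (r : R) (k : nat) : R -> R := Rr (r `^ (k%:R)^-1).
Definition dactR (r : R) (k : nat) : R -> R := (Rr (r `^ (k%:R)^-1))^`().
Definition actI (k : nat) : R -> R := @relu R.
Definition dactI (k : nat) (y : R) : R := (0 < y)%R%:R.

(* For a fixed input the smoothed realization and its parameter derivatives
   do not just converge: they are eventually equal to their ReLU versions. *)
Lemma near_net (th : 'rV[R]_d) (x : nat -> R) j k i : \forall r \near +oo,
  net l (actR r) th x k i = net l actI th x k i /\
  dnet l (actR r) (dactR r) th j x k i = dnet l actI dactI th j x k i.
Proof.
elim: k i => [|k IH] i; first exact: nearW.
have IHn : \forall r \near +oo, forall n, (n < (l k).+1)%N ->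
    net l (actR r) th x k n = net l actI th x k n /\
    dnet l (actR r) (dactR r) th j x k n = dnet l actI dactI th j x k n.
  by apply: near_forall_lt => n; exact: IH.
have actn : \forall r \near +oo, forall n, (n < (l k).+1)%N ->
    (0 < k)%N -> actR r k (net l actI th x k n) = relu (net l actI th x k n) /\
      dactR r k (net l actI th x k n) = (0 < net l actI th x k n)%R%:R.
  apply: near_forall_lt => n; case: k {IH IHn} => [|k]; first exact: nearW.
  by near=> r => _; near: r; exact: near_Rr.
apply: filterS2 IHn actn => r IHr actr {IH}.
have hidE n : (n < (l k).+1)%N -> hid l (actR r) th x k n = hid l actI th x k n.
  by case: k IHr actr => // k IHr actr nk; rewrite /hid (IHr _ nk).1 (actr _ nk _).1.
split; first by rewrite !netS; congr (_ + _); apply: eq_big_nat => n /andP[_ nk]; rewrite hidE.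
move=> /=; congr (_ + _); apply: eq_big_nat => n /andP[_ nk]; rewrite hidE//.
congr (_ + _ * _); rewrite (IHr _ nk).1 (IHr _ nk).2.
(* At [k = 0] the derivatives of the activations are multiplied by the zero derivative of the
   input. *)
case: k IHr actr nk {hidE} => [|k] IHr actr nk; first by rewrite !mulr0.
by rewrite (actr _ nk _).2.
Unshelve. all: by end_near. Qed.

End Limit.

(** * Integration *)

Section Integration.
Context {disp : measure_display} {T : measurableType disp} {R : realType}.
Variables (mu : {measure set T -> \bar R}) (X : set T).
Hypothesis mX : measurable X.

Lemma Rintegral_sum (I : Type) (s : seq I) (F : I -> T -> R) :
  (forall i, mu.-integrable X (EFin \o F i)) ->
  mu.-integrable X (EFin \o (fun x => \sum_(i <- s) F i x)) /\
  Rintegral mu X (fun x => \sum_(i <- s) F i x) = \sum_(i <- s) Rintegral mu X (F i).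
Proof.
move=> iF; elim: s => [|i s [IHi IH]].
  rewrite big_nil; under eq_fun do rewrite big_nil.
  split; first exact: integrable0.
  by rewrite Rintegral_cst// mul0r.
rewrite big_cons -IH -RintegralD//; split; last first.
  by apply: eq_Rintegral => x _; rewrite big_cons.
under eq_fun do rewrite big_cons.
exact: (@integrableD _ _ _ mu X mX _ _ (iF i) IHi).
Qed.

Lemma integrable_le (F g : T -> R) : measurable_fun X F ->
  mu.-integrable X (EFin \o g) -> (forall x, X x -> `|F x| <= g x) ->
  mu.-integrable X (EFin \o F).
Proof.
move=> mF ig Fg; apply: le_integrable ig => //; first exact/measurable_EFinP.
by move=> x Xx /=; rewrite lee_fin (le_trans (Fg _ Xx))// ler_norm.
Qed.

Lemma integrable_cst (c : R) : (mu X < +oo)%E -> mu.-integrable X (EFin \o cst c).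
Proof.
move=> muX; apply: measurable_bounded_integrable => //.
exists `|c|; split; first exact: num_real.
by move=> y cy x _; exact: ltW.
Qed.

(** Convergence at infinity is tested on sequences, shifted so that all terms are at least 1. *)
Lemma dominated_cvg_pinfty (F : R -> T -> R) (G g : T -> R) :
  (forall r, 1 <= r -> measurable_fun X (F r)) -> measurable_fun X G ->
  (forall x, X x -> F r x @[r --> +oo] --> G x) ->
  mu.-integrable X (EFin \o g) ->
  (forall r x, 1 <= r -> X x -> `|F r x| <= g x) ->
  Rintegral mu X (F r) @[r --> +oo] --> Rintegral mu X G.
Proof.
move=> mF mG FG ig Fg; apply/cvg_pinftyP => u uoo.
have [N _ uN] : \forall n \near \oo, 1 <= u n by move/cvgryPge : uoo; exact.
rewrite -(cvg_shiftn N).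
have u1 n : 1 <= u (n + N)%N by apply: uN => /=; exact: leq_addl.
have FGn : {ae mu, forall x, X x -> (F (u (n + N)%N) x)%:E @[n --> \oo] --> (G x)%:E}.
  apply/aeW => x Xx; apply: cvg_EFin; first exact: nearW.
  by have /cvg_pinftyP/(_ _ uoo) := FG _ Xx; rewrite -(cvg_shiftn N).
have Fgn : {ae mu, forall x n, X x -> (`|(F (u (n + N)%N) x)%:E| <= (EFin \o g) x)%E}.
  by apply/aeW => x n Xx; rewrite lee_fin Fg.
have mFn n : measurable_fun X (fun x => (F (u (n + N)%N) x)%:E).
  by apply/measurable_EFinP; exact: mF.
have mGE : measurable_fun X (EFin \o G) by exact/measurable_EFinP.
have [iG _ cvgF] := @dominated_convergence _ _ _ mu X mX
  (fun n x => (F (u (n + N)%N) x)%:E) (EFin \o G) (EFin \o g) mFn mGE FGn ig Fgn.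
apply: fine_cvg; rewrite fineK //; exact: integrable_fin_num.
Qed.

(** Cauchy-Schwarz against the constant 1, read off from the nonnegativity of the integral of
    [(g - c)^2] as a quadratic in [c]. *)
Lemma sqr_Rintegral_le (g : T -> R) : (mu X < +oo)%E ->
  mu.-integrable X (EFin \o g) -> mu.-integrable X (EFin \o (fun x => g x ^+ 2)) ->
  (Rintegral mu X g) ^+ 2 <= fine (mu X) * Rintegral mu X (fun x => g x ^+ 2).
Proof.
move=> muX ig ig2; set I := Rintegral mu X g; set Q := Rintegral mu X _.
set m := fine (mu X); have m0 : 0 <= m by rewrite fine_ge0.
have quad c : 0 <= Q - 2 * c * I + c ^+ 2 * m.
  have igc : mu.-integrable X (EFin \o (fun x => 2 * c * g x)).
    exact: (@integrableZl _ _ _ mu X mX (2 * c) _ ig).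
  have <- : Rintegral mu X (fun x => (g x - c) ^+ 2) = Q - 2 * c * I + c ^+ 2 * m.
    rewrite -[c ^+ 2 * m]Rintegral_cst// -RintegralZl// -RintegralB// -RintegralD//.
    - by apply: eq_Rintegral => x _; ring.
    - exact: (@integrableB _ _ _ mu X mX _ _ ig2 igc).
    - exact: integrable_cst.
  by apply: Rintegral_ge0 => x _; exact: sqr_ge0.
(* For zero mass the quadratic is affine, and a nonzero [I] would give it the value -1 at the chosen
   [c]. Otherwise [c = I / m] is its minimiser. *)
have [m00|mn0] := eqVneq m 0.
  have [->|I0] := eqVneq I 0; first by rewrite expr0n m00 mul0r.
  have := quad ((Q + 1) / (2 * I)); rewrite m00 mulr0 addr0.
  rewrite (_ : 2 * _ * I = Q + 1); last by field.
  by rewrite opprD addrA subrr add0r ler0N1.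
have := quad (I / m); rewrite (_ : _ + _ = Q - I ^+ 2 / m); last by field.
by rewrite subr_ge0 ler_pdivrMr ?lt_neqAle ?m0 ?[0 == m]eq_sym ?mn0// mulrC.
Qed.

End Integration.

Lemma cvg_row (R : realType) (d : nat) (F : R -> 'rV[R]_d) (v : 'rV[R]_d) :
  (forall j, F r 0 j @[r --> +oo] --> v 0 j) -> F @ +oo --> v.
Proof.
move=> Fv; apply/cvg_mx_entourageP => A eA.
have : \forall r \near +oo, forall j : 'I_d, A (v 0 j, F r 0 j).
  apply: filter_forall => j.
  by have /cvg_app_entourageP := Fv j; exact.
by apply: filterS => r Ar i j; rewrite ord1 inE; exact: Ar.
Qed.

(** Reduces partial derivatives to one real variable, the form in which differentiation under the
    integral applies. *)
Lemma derive_line (R : realType) (d : nat) (F : 'rV[R]_d -> R) (t v : 'rV[R]_d) :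
  'D_v F t = (fun s : R => F (t + s *: v))^`() 0.
Proof.
rewrite /derive /derive1.
have -> : (fun h : R => h^-1 *: ((F \o shift t) (h *: v) - F t)) =
  (fun h : R => h^-1 *: (F (t + (h + 0) *: v) - F (t + 0 *: v))).
  by apply/funext => h /=; rewrite addr0 scale0r addr0 [h *: v + t]addrC.
by [].
Qed.

Lemma measurable_cube (R : realType) n (a b : R) : measurable (cube n a b).
Proof.
rewrite (_ : cube n a b = \bigcap_(i in [set: 'I_n]) ((@tnth n R ^~ i) @^-1` `[a, b])).
  apply: fin_bigcap_measurable => // i _; rewrite -[_ @^-1` _]setTI.
  by apply: measurable_tnth => //; exact: measurable_itv.
apply/seteqP; split => x /= h i; first by move=> _ /=; rewrite in_itv/=.
by have := h i I; rewrite /= in_itv.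
Qed.

(** * The gradient of the loss, its limit, and the bound of item (iv) *)

Section Loss.
Context {R : realType} {d : nat}.
Variables (l : nat -> nat) (L : nat) (a b : R).
Variables (mu : {measure set ((l 0).-tuple R) -> \bar R}).
Variable f : (l 0).-tuple R -> (l L).-tuple R.
Local Notation X := (cube (l 0) a b).
Local Notation ba := (Num.max `|a| (Num.max `|b| 1)).
Local Notation fc x i := (nth 0 (tval (f x)) i.-1).

Lemma ba_ge1 : 1 <= ba.
Proof. by rewrite !le_max lexx !orbT. Qed.

Lemma tin_cube_le x j : X x -> `|tin x j| <= ba.
Proof.
move=> Xx; have [jl|jl] := ltnP j.-1 (l 0); last first.
  by rewrite /tin nth_default ?size_tuple// normr0 (le_trans ler01 ba_ge1).
have /andP[ax xb] := Xx (Ordinal jl).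
rewrite /tin -[j.-1]/(nat_of_ord (Ordinal jl)) -tnth_nth ler_norml.
apply/andP; split; last by rewrite (le_trans xb)// !le_max ler_norm orbT.
rewrite lerNl (le_trans _ (_ : `|a| <= _)) ?le_max ?lexx//.
by apply: (@le_trans _ _ (- a)); rewrite ?lerN2// -normrN ler_norm.
Qed.

Definition sqerr_grad (act dact : nat -> R -> R) (th : 'rV[R]_d) j x : R :=
  \sum_(1 <= i < (l L).+1)
    2 * (net l act th (tin x) L i - fc x i) * dnet l act dact th j (tin x) L i.

Lemma is_derive_sqerr (act dact : nat -> R -> R) (th : 'rV[R]_d) (j : 'I_d) x (h : R) :
  (forall k y, is_derive y (1 : R) (act k) (dact k y)) ->
  is_derive h (1 : R)
    (fun s => sqerr (net l act (th + s *: delta_mx 0 j) (tin x) L) (f x))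
    (sqerr_grad act dact (th + h *: delta_mx 0 j) j x).
Proof.
move=> act_dact; rewrite /sqerr /sqerr_grad; apply: is_derive_bigsum => i.
under eq_fun do rewrite expr2.
have dN : is_derive h (1 : R)
    (fun s => net l act (th + s *: delta_mx 0 j) (tin x) L i - fc x i)
    (dnet l act dact (th + h *: delta_mx 0 j) j (tin x) L i).
  have := is_deriveB (is_derive_net l act dact th j (tin x) act_dact L i h)
    (is_derive_cst (fc x i : R) h (1 : R)).
  by rewrite subr0.
set u := net l _ _ _ _ _ - _; set v := dnet _ _ _ _ _ _ _ _ in dN *.
rewrite (_ : 2 * u * v = v * u + u * v); last by ring.
by have := is_derive_mul _ _ _ _ _ dN dN.
Qed.

(** Supplies the dominating function. The gradient grows linearly in [f], and [|z| <= 1 + z^2]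
    trades this for the squared norm of [f], whose integrability is available. *)
Lemma sqerr_grad_bounded (M D : R) : 0 <= M -> 0 <= D -> ba <= M ->
  exists2 K : R, 0 <= K & forall act dact (th : 'rV[R]_d) j x,
    (forall k y, `|act k y| <= `|y|) -> (forall k y, `|dact k y| <= D) ->
    (forall n, `|coord th n| <= M) -> X x ->
    `|sqerr_grad act dact th j x| <= K + K * sqerr (fun=> 0) (f x).
Proof.
move=> M0 D0 baM; have [C C0 HC] := @net_bounded R d l M M0 L.
have [C' C'0 HC'] := @dnet_bounded R d l M D M0 D0 L.
pose K1 := 2 * (C + 1) * C'; have K10 : 0 <= K1 by rewrite !mulr_ge0// addr_ge0.
have l0 : 0 <= (l L)%:R :> R by [].
exists (((l L)%:R + 1) * K1); first by rewrite mulr_ge0// addr_ge0.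
move=> act dact th j x act_le dact_le thM Xx.
have xM n : `|tin x n| <= M by apply: le_trans (tin_cube_le _ n Xx) baM.
have S0 : 0 <= sqerr (fun=> 0) (f x) by apply: sumr_ge0 => *; exact: sqr_ge0.
apply: (@le_trans _ _ (\sum_(1 <= i < (l L).+1) (K1 + K1 * (0 - fc x i) ^+ 2))).
  apply: le_trans (ler_norm_sum _ _ _) _; apply: ler_sum => i _.
  rewrite !normrM normr_nat; set N := net _ _ _ _ _ _; set N' := dnet _ _ _ _ _ _ _ _.
  have NC : `|N| <= C by exact: HC.
  have NC' : `|N'| <= C' by exact: HC'.
  have fle : `|fc x i| <= 1 + (0 - fc x i) ^+ 2.
    rewrite sub0r sqrrN -real_normK ?num_real//; set z := `|_|.
    by have z0 : 0 <= z := normr_ge0 _; nra.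
  have le1 : `|N - fc x i| <= (C + 1) * (1 + (0 - fc x i) ^+ 2).
    apply: le_trans (ler_normB _ _) _; have := sqr_ge0 (0 - fc x i); nra.
  set s := (0 - _) ^+ 2 in fle le1 *.
  have -> : K1 + K1 * s = 2 * ((C + 1) * (1 + s)) * C' by rewrite /K1; ring.
  by apply: ler_pM => //; rewrite ler_wpM2l.
rewrite big_split /= sum_const_1n -mulr_sumr -/(sqerr (fun=> 0) (f x)).
have := mulr_ge0 (mulr_ge0 l0 K10) S0.
by rewrite !mulrDl !mul1r; lra.
Qed.

(** Cauchy-Schwarz over the output index for each [j]; the 4 is the square of the factor 2 in the
    derivative of a square. *)
Lemma sqerr_grad_sum_sqr (act dact : nat -> R -> R) (th : 'rV[R]_d) x :
  \sum_(j < d) sqerr_grad act dact th j x ^+ 2 <=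
  4 * sqerr (net l act th (tin x) L) (f x) * jac l act dact th (tin x) L.
Proof.
rewrite /jac exchange_big /= mulr_sumr; apply: ler_sum => j _.
apply: le_trans (CauchySchwarz_sum _ _ _ _) _.
rewrite ler_wpM2r//; first by apply: sumr_ge0 => *; exact: sqr_ge0.
rewrite /sqerr mulr_sumr; apply: ler_sum => i _.
by rewrite exprMn -natrX.
Qed.

Section Measurability.
Variables (act dact : nat -> R -> R) (th : 'rV[R]_d).
Hypothesis mf : measurable_fun X f.
Hypothesis mact : forall k, measurable_fun setT (act k).
Hypothesis mdact : forall k, measurable_fun setT (dact k).

Lemma measurable_fc i : measurable_fun X (fun x => fc x i).
Proof.
have [il|il] := ltnP i.-1 (l L); last first.
  rewrite (_ : (fun _ => _) = cst 0)//; apply/funext => x.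
  by rewrite nth_default ?size_tuple.
rewrite (_ : (fun _ => _) = (fun y => tnth y (Ordinal il)) \o f).
  by apply: measurableT_comp => //; exact: measurable_tnth.
by apply/funext => x /=; rewrite (tnth_nth 0).
Qed.

Lemma measurable_sqerr_grad j : measurable_fun X (sqerr_grad act dact th j).
Proof.
apply: measurable_sum => i; apply: measurable_funM.
  apply: measurable_funM => //; apply: measurable_funB; last exact: measurable_fc.
  by apply: measurable_funTS; exact: measurable_net.
by apply: measurable_funTS; exact: measurable_dnet.
Qed.

End Measurability.

Section Gradient.
Hypothesis muX : (mu X < +oo)%E.
Hypothesis mf : measurable_fun X f.
Hypothesis if0 : mu.-integrable X (fun x => (sqerr (fun=> 0) (f x))%:E).

Lemma coord_le_norm (th : 'rV[R]_d) n : `|coord th n| <= \sum_(j < d) `|th 0 j|.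
Proof.
have [nd|nd] := ltnP n d; last by rewrite coord_ge// normr0 sumr_ge0.
rewrite -[n]/(nat_of_ord (Ordinal nd)) coord_ord (bigD1 (Ordinal nd))//=.
by rewrite lerDl sumr_ge0.
Qed.

Lemma integrable_dominator (K : R) :
  mu.-integrable X (EFin \o (fun x => K + K * sqerr (fun=> 0) (f x))).
Proof.
have mX := measurable_cube R (l 0) a b.
have iK := integrable_cst mu X mX K muX.
exact: (@integrableD _ _ _ mu X mX _ _ iK (@integrableZl _ _ _ mu X mX K _ if0)).
Qed.

Lemma sqerr_ge0 (N : nat -> R) (y : (l L).-tuple R) : 0 <= sqerr N y.
Proof. by apply: sumr_ge0 => *; exact: sqr_ge0. Qed.

Lemma derive_loss (act dact : nat -> R -> R) (D : R) (th : 'rV[R]_d) (j : 'I_d) :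
  (forall k y, is_derive y (1 : R) (act k) (dact k y)) ->
  (forall k y, `|act k y| <= `|y|) -> (forall k y, `|dact k y| <= D) ->
  (forall t : 'rV[R]_d, mu.-integrable X
     (fun x => (sqerr (net l act t (tin x) L) (f x))%:E)) ->
  'D_(delta_mx 0 j) (fun t : 'rV[R]_d =>
     Rintegral mu X (fun x => sqerr (net l act t (tin x) L) (f x))) th =
  Rintegral mu X (sqerr_grad act dact th j).
Proof.
move=> act_dact act_le dact_le isq.
have D0 : 0 <= D by apply: le_trans (dact_le 0 0).
(* Bounds the inputs and all coordinates along [th + s *: delta_mx 0 j] with [|s| < 1], which move
   by at most 1. *)
pose M := \sum_(j < d) `|th 0 j| + 1 + ba.
have S0 : 0 <= \sum_(j < d) `|th 0 j| by rewrite sumr_ge0.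
have baM : ba <= M by rewrite lerDr addr_ge0.
have M0 : 0 <= M by rewrite (le_trans _ baM)// (le_trans ler01 ba_ge1).
have [K K0 HK] := sqerr_grad_bounded M D M0 D0 baM.
pose F (s : R) x := sqerr (net l act (th + s *: delta_mx 0 j) (tin x) L) (f x).
have dF s x : is_derive s (1 : R) (F ^~ x) (sqerr_grad act dact (th + s *: delta_mx 0 j) j x).
  exact: is_derive_sqerr.
have d1F s x : (F ^~ x)^`() s = sqerr_grad act dact (th + s *: delta_mx 0 j) j x.
  by rewrite derive1E; exact: derive_val.
rewrite derive_line.
have I0 : `](-1), 1[%classic (0 : R) by rewrite /= in_itv/= ltrN10 ltr01.
rewrite (@differentiation_under_integral R _ _ mu F X (measurable_cube _ _ _ _) 0 (-1) 1 I0
  _ _ (fun x => K + K * sqerr (fun=> 0) (f x))).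
- apply: eq_Rintegral => x _; rewrite /= /partial1of2 d1F scale0r addr0 //.
- by move=> s _; exact: isq.
- by move=> s x _ _; exact: ex_derive.
- by move=> x; rewrite addr_ge0// mulr_ge0// sqerr_ge0.
- exact: integrable_dominator.
- move=> s x; rewrite /= in_itv/= => /andP[s1 s2] Xx; rewrite /partial1of2 d1F.
  apply: HK => // n; rewrite coord_shift /M.
  apply: le_trans (ler_normD _ _) _; rewrite -[leLHS]addr0 lerD//.
  apply: lerD; first exact: coord_le_norm.
  have s_le1 : `|s| <= 1 by rewrite ler_norml !ltW.
  by case: (_ == _); rewrite ?mulr1 // mulr0 normr0.
Qed.

Section Limit.
Variables (A B : R) (Rr : R -> R -> R).
Hypothesis hA : 0 < A.
Hypothesis hRr : forall r, 1 <= r ->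
     [/\ (forall x, derivable (Rr r) x 1), continuous (Rr r)^`(),
         (forall x, x <= A * r^-1 -> Rr r x = 0),
         (forall y, 0 <= Rr r y <= Num.max y 0) &
         (forall z, B * r^-1 <= z -> Rr r z = z)].
Variable D : R.
Hypothesis hRbd : forall r x, 1 <= r -> `|(Rr r)^`() x| <= D.
Hypothesis hint : forall (r : R) (t : 'rV[R]_d), 1 <= r ->
     mu.-integrable X (fun x => (sqerr (netR l Rr r t x L) (f x))%:E).

Lemma act_ge1 (r : R) k : 1 <= r -> 1 <= r `^ (k%:R)^-1.
Proof. by move=> r1; rewrite ge1_powR ?invr_ge0. Qed.

Lemma relu_le (y : R) : `|relu y| <= `|y|.
Proof. by rewrite /relu /Num.max; case: ifP; rewrite ?normr0. Qed.

Lemma actR_le (r : R) k y : 1 <= r -> `|actR Rr r k y| <= `|y|.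
Proof.
move=> r1; have [_ _ _ /(_ y)/andP[h0 h1] _] := hRr _ (act_ge1 r k r1).
rewrite /actR ger0_norm// (le_trans h1)// (le_trans (ler_norm _))//.
exact: relu_le.
Qed.

Lemma dactR_le (r : R) k y : 1 <= r -> `|dactR Rr r k y| <= D.
Proof. by move=> r1; exact: hRbd (act_ge1 _ _ r1). Qed.

Lemma is_derive_actR (r : R) k y : 1 <= r ->
  is_derive y (1 : R) (actR Rr r k) (dactR Rr r k y).
Proof.
move=> r1; have [dR _ _ _ _] := hRr _ (act_ge1 r k r1).
by apply: DeriveDef; [exact: dR|rewrite /dactR derive1E].
Qed.

Lemma measurable_actR (r : R) k : 1 <= r -> measurable_fun setT (actR Rr r k).
Proof.
move=> r1; have [dR _ _ _ _] := hRr _ (act_ge1 r k r1).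
apply: continuous_measurable_fun => y.
by apply/differentiable_continuous/derivable1_diffP; exact: dR.
Qed.

Lemma measurable_dactR (r : R) k : 1 <= r -> measurable_fun setT (dactR Rr r k).
Proof.
move=> r1; have [_ cR _ _ _] := hRr _ (act_ge1 r k r1).
exact: continuous_measurable_fun.
Qed.

Lemma measurable_actI k : measurable_fun setT (@actI R k).
Proof. exact: measurable_maxr. Qed.

Lemma measurable_dactI k : measurable_fun setT (@dactI R k).
Proof.
rewrite (_ : dactI k = \1_`]0, +oo[%classic); first exact: measurable_indic.
by apply/funext => y; rewrite /dactI indicE mem_setE in_itv/= andbT.
Qed.

Lemma dactI_le (k : nat) (y : R) : `|dactI k y| <= 1.
Proof. by rewrite /dactI; case: (_ < _); rewrite ?normr1 ?normr0. Qed.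

Definition limit_grad (th : 'rV[R]_d) : 'rV[R]_d :=
  \row_j Rintegral mu X (sqerr_grad (@actI R) (@dactI R) th j).

(** The gradients converge at every parameter, so the defining property of [G] determines it
    everywhere. *)
Lemma cvg_grad (th : 'rV[R]_d) :
  (fun r => grad (lossR l L Rr mu a b f r) th) @ +oo --> limit_grad th.
Proof.
apply: cvg_row => j; rewrite mxE.
have D0 : 0 <= D by apply: le_trans (hRbd 1 0 _).
pose M := \sum_(j < d) `|th 0 j| + ba.
have S0 : 0 <= \sum_(j < d) `|th 0 j| by rewrite sumr_ge0.
have ba0 : 0 <= ba := le_trans ler01 ba_ge1.
have baM : ba <= M by rewrite lerDr.
have [K K0 HK] := sqerr_grad_bounded M D (addr_ge0 S0 ba0) D0 baM.
have : Rintegral mu X (sqerr_grad (actR Rr r) (dactR Rr r) th j) @[r --> +oo] -->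
    Rintegral mu X (sqerr_grad (@actI R) (@dactI R) th j).
  apply: (@dominated_cvg_pinfty _ _ _ mu X (measurable_cube _ _ _ _) _ _
    (fun x => K + K * sqerr (fun=> 0) (f x))).
  - move=> r r1; apply: measurable_sqerr_grad => // k;
      [exact: measurable_actR|exact: measurable_dactR].
  - by apply: measurable_sqerr_grad => // k;
      [exact: measurable_actI|exact: measurable_dactI].
  (* By [near_net] the integrand at a fixed [x] is eventually constant in [r], simultaneously for
     the finitely many outputs. *)
  - move=> x Xx; apply: cvg_near_cst.
    have : \forall r \near +oo, forall i, (i < (l L).+1)%N ->
        net l (actR Rr r) th (tin x) L i = net l (@actI R) th (tin x) L i /\
        dnet l (actR Rr r) (dactR Rr r) th j (tin x) L i =
          dnet l (@actI R) (@dactI R) th j (tin x) L i.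
      apply: near_forall_lt => i; apply: near_net hA _ _ _ _ _ _ _.
      - by move=> r y r1; have [_ _ h _ _] := hRr _ r1; exact: h.
      - by move=> r y r1; have [_ _ _ _ h] := hRr _ r1; exact: h.
    apply: filterS => r h; rewrite /sqerr_grad; apply: eq_big_nat => i /andP[_ il].
    by rewrite (h _ il).1 (h _ il).2.
  - exact: integrable_dominator.
  - move=> r x r1 Xx; apply: HK => // [k y|k y|n].
    + exact: actR_le.
    + exact: dactR_le.
    + by rewrite (le_trans (coord_le_norm _ _))// lerDl.
apply: cvg_trans; apply: near_eq_cvg; near=> r.
have r1 : 1 <= r by near: r; exact: nbhs_pinfty_ge.
rewrite /grad mxE; apply/esym/(@derive_loss (actR Rr r) (dactR Rr r) D).
- by move=> k y; exact: is_derive_actR.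
- by move=> k y; exact: actR_le.
- by move=> k y; exact: dactR_le.
- by move=> t; exact: hint.
Unshelve. all: by end_near. Qed.

End Limit.

Lemma limit_grad_le (th : 'rV[R]_d) : (0 < L)%N -> d = dk l L ->
  mu.-integrable X (fun x => (sqerr (netInf l th x L) (f x))%:E) ->
  enorm (limit_grad th) ^+ 2 <=
    4 * L%:R * fine (mu X) * ba ^+ 2 * (\prod_(0 <= p < L.+1) ((l p)%:R + 1)) *
    (enorm th ^+ 2 + 1) ^+ L.-1 * lossInf l L mu a b f th.
Proof.
move=> L0 hd isq; have mX := measurable_cube R (l 0) a b.
set P := \prod_(0 <= p < L.+1) _; set T := (enorm th ^+ 2 + 1) ^+ L.-1.
set m := fine (mu X); have m0 : 0 <= m by rewrite fine_ge0.
pose g j x := sqerr_grad (@actI R) (@dactI R) th j x.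
(* The 4 comes from [sqerr_grad_sum_sqr], the rest is [jac_le] for the last layer. *)
pose C := 4 * (L%:R * ba ^+ 2 * P * T).
have sum_g x : X x -> \sum_(j < d) g j x ^+ 2 <= C * sqerr (netInf l th x L) (f x).
  move=> Xx; apply: le_trans (sqerr_grad_sum_sqr _ _ _ _) _.
  rewrite /C mulrAC -!(mulrA 4) ler_wpM2l// ler_wpM2r ?sqerr_ge0//.
  have := @jac_le R d l (@actI R) (@dactI R) th (tin x) ba ba_ge1
    (fun i => tin_cube_le x i Xx) (fun k => relu_le) L hd (fun k => dactI_le k) L.-1.
  by rewrite prednK//; apply.
have mg j : measurable_fun X (g j).
  by apply: measurable_sqerr_grad => // k; [exact: measurable_actI|exact: measurable_dactI].
have iC : mu.-integrable X (EFin \o (fun x => C * sqerr (netInf l th x L) (f x))).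
  exact: (@integrableZl _ _ _ mu X mX C _ isq).
have ig2 (j : 'I_d) : mu.-integrable X (EFin \o (fun x => g j x ^+ 2)).
  apply: (integrable_le mu X mX _ _ _ iC); first exact: measurable_funX.
  move=> x Xx; rewrite ger0_norm ?sqr_ge0//; apply: le_trans (sum_g x Xx).
  by rewrite (bigD1 j)//= lerDl sumr_ge0// => *; exact: sqr_ge0.
have ig (j : 'I_d) : mu.-integrable X (EFin \o g j).
  have i1 : mu.-integrable X (EFin \o (fun x => 1 + g j x ^+ 2)).
    exact: (@integrableD _ _ _ mu X mX _ _ (integrable_cst mu X mX 1 muX) (ig2 j)).
  apply: (integrable_le mu X mX _ _ (mg j) i1) => x _.
  rewrite -real_normK ?num_real//; set z := `|_|.
  by have := sqr_ge0 (z - 1); rewrite sqrrB1 => z1; have z0 : 0 <= z := normr_ge0 _; nra.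
rewrite /enorm sqr_sqrtr ?sumr_ge0// => [|j _]; last exact: sqr_ge0.
have [isum sumE] := Rintegral_sum mu X mX _ (index_enum 'I_d) (fun j x => g j x ^+ 2) ig2.
(* Cauchy-Schwarz in the measure, coordinate by coordinate, produces the mass [m]. *)
apply: (@le_trans _ _ (m * Rintegral mu X (fun x => \sum_(j < d) g j x ^+ 2))).
  rewrite sumE mulr_sumr; apply: ler_sum => j _; rewrite mxE.
  exact: sqr_Rintegral_le.
apply: (@le_trans _ _ (m * (C * lossInf l L mu a b f th))).
  rewrite ler_wpM2l// /lossInf -RintegralZl//; exact: le_Rintegral.
rewrite le_eqVlt; apply/orP; left; apply/eqP; rewrite /C; ring.
Qed.

End Gradient.
End Loss.

Theorem theorem2p11 (R : realType) (L d : nat) (l : nat -> nat) (a b A B : R)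
  (Rr : R -> R -> R) (mu : {measure set ((l 0).-tuple R) -> \bar R})
  (f : (l 0).-tuple R -> (l L).-tuple R) (G : 'rV[R]_d -> 'rV[R]_d)
  (th : 'rV[R]_d)
  (hL : (0 < L)%N) (hl : forall k, (0 < l k)%N) (hd : d = dk l L)
  (hab : a < b) (hA : 0 < A) (hAB : A < B)
  (hRr : forall r, 1 <= r ->
     [/\ (forall x, derivable (Rr r) x 1), continuous (Rr r)^`(),
         (forall x, x <= A * r^-1 -> Rr r x = 0),
         (forall y, 0 <= Rr r y <= Num.max y 0) &
         (forall z, B * r^-1 <= z -> Rr r z = z)])
  (hRbd : exists C : R, forall r x, 1 <= r -> `|(Rr r)^`() x| <= C)
  (hm : (mu (cube (l 0%N) a b) < +oo)%E)
  (hf : measurable_fun (cube (l 0) a b) f)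
  (hint : forall (r : R) (t : 'rV[R]_d), 1 <= r ->
     mu.-integrable (cube (l 0) a b)
       (fun x => (sqerr (netR l Rr r t x L) (f x))%:E))
  (hintInf : forall t : 'rV[R]_d,
     mu.-integrable (cube (l 0) a b)
       (fun x => (sqerr (netInf l t x L) (f x))%:E))
  (hG : forall (t v : 'rV[R]_d),
     (fun r : R => grad (lossR l L Rr mu a b f r) t) @ +oo --> v -> G t = v) :
  let ba := Num.max `|a| (Num.max `|b| 1) in
  [/\ (* (i) *)
      (forall (k i : nat) (x : (l 0).-tuple R),
         (1 <= k <= L)%N -> (1 <= i <= l k)%N -> cube (l 0) a b x ->
         `|relu (netInf l th x k i)| ^+ 2 <= `|netInf l th x k i| ^+ 2 <=
           ba ^+ 2 * Qki l th k i *
           \prod_(0 <= p < k) (((l p)%:R + 1) * Qk l th p)),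
      (* (ii) *)
      (forall K : nat, (1 <= K <= L)%N ->
         \prod_(0 <= p < K.+1) Qk l th p <= (enorm th ^+ 2 + 1) ^+ K),
      (* (iii) *)
      (forall K k i : nat, (1 <= K <= L)%N -> (1 <= k <= K)%N ->
         (1 <= i <= l k)%N ->
         pathsum l th L K k i <= enorm th ^+ (2 * (K - k))) &
      (* (iv) *)
      enorm (G th) ^+ 2 <=
        4 * L%:R * fine (mu (cube (l 0) a b)) * ba ^+ 2 *
        (\prod_(0 <= p < L.+1) ((l p)%:R + 1)) *
        (enorm th ^+ 2 + 1) ^+ L.-1 * lossInf l L mu a b f th].
Proof.
move=> ba; have ba1 : 1 <= ba by exact: ba_ge1.
have l1 k : (0 < k)%N -> exists k', k = k'.+1 by case: k => // k _; exists k.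
split.
- move=> [//|k] i x /andP[_ kL] _ Xx; apply/andP; split.
    by rewrite lerXn2r ?nnegrE// relu_le.
  exact: (@sqr_net_le R d l (@actI R) th (tin x) ba ba1
    (fun i => tin_cube_le l a b x i Xx) (fun k => @relu_le R)).
- by move=> K /andP[_ KL]; exact: prod_Qk_le hd _ KL.
- by move=> K k i /andP[_ KL] kK il; exact: pathsum_le.
have [D hD] := hRbd.
(* With zero parameters the network vanishes, so integrability of the ReLU loss at 0 is that of the
   squared norm of [f]. *)
have if0 : mu.-integrable (cube (l 0) a b) (fun x => (sqerr (fun=> 0) (f x))%:E).
  have net0 x : netInf l (0 : 'rV[R]_d) x L = fun=> 0.
    have c0 n : coord (0 : 'rV[R]_d) n = 0.
      by rewrite /Defs.coord; case: insubP => // *; rewrite mxE.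
    case: (L) hL => // L' _; apply/funext => i; rewrite /netInf netS /bia /wgt c0 add0r.
    by apply: big1 => n _; rewrite c0 mul0r.
  by have := hintInf 0; under eq_fun do rewrite net0.
have cvgG := @cvg_grad R d l L a b mu f hm hf if0 A B Rr hA hRr D (fun r x => hD r x) hint th.
rewrite (hG _ _ cvgG).
exact: limit_grad_le.
Qed.
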